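(* Let $T\in(0,\infty)$, $\alpha\in\mathbb{R}$, and let $(X^{(\alpha)}_t)_{t\in[0,T)}$ be the unique strong solution of \[ \mathrm{d} X^{(\alpha)}_t=-\frac{\alpha}{T-t}X^{(\alpha)}_t\,\mathrm{d} t+\mathrm{d} B_t,\quad t\in[0,T),\qquad X^{(\alpha)}_0=0, \] where $(B_t)_{t\in[0,T)}$ is a standard Wiener process. Then for all $\mu>0$, $\nu\ge0$ and $t\in[0,T)$, writing $D:=\sqrt{8\mu+(2\alpha-1)^2}$ and $L:=\ln\left(1-\frac tT\right)$, \[ \mathsf{E}\exp\left\{-\mu\int_0^t\frac{(X^{(\alpha)}_u)^2}{(T-u)^2}\,\mathrm{d} u-\nu(X^{(\alpha)}_t)^2\right\} =\frac{\left(1-\frac tT\right)^{(1-2\alpha)/4}}{\sqrt{\cosh\left(\frac D2L\right)+\frac{1-2\alpha-4\nu(T-t)}{D}\sinh\left(\frac D2L\right)}}. \] *)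

(* Defs.v *)
From HB Require Import structures.
From mathcomp Require Import all_boot all_order all_algebra.
From mathcomp Require Import all_classical all_reals all_analysis.
Set Implicit Arguments. Unset Strict Implicit. Unset Printing Implicit Defensive.
Import Order.TTheory GRing.Theory Num.Theory.
Import numFieldNormedType.Exports.
Local Open Scope classical_set_scope.
Local Open Scope ring_scope.

Definition coshR {R : realType} (x : R) : R := (expR x + expR (- x)) / 2.
Definition sinhR {R : realType} (x : R) : R := (expR x - expR (- x)) / 2.

Definition mutually_independent_rvs d (Omega : measurableType d) (R : realType)
    (P : probability Omega R) (n : nat) (Y : 'I_n -> Omega -> R) : Prop :=
  forall A : 'I_n -> set R, (forall i, measurable (A i)) ->
    P (\big[setI/setT]_(i < n) (Y i @^-1` A i)) =
    (\prod_(i < n) P (Y i @^-1` A i))%E.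

Definition standard_Wiener_process d (Omega : measurableType d) (R : realType)
    (P : probability Omega R) (T : R) (B : R -> Omega -> R) : Prop :=
  [/\
      (forall t, 0 <= t < T -> measurable_fun setT (B t)),
      {ae P, forall w, B 0 w = 0},
      (forall w, {within `[0, T[, continuous (fun t => B t w)}),
      (forall s t, 0 <= s -> s < t -> t < T ->
         forall A : set R, measurable A ->
           P ((fun w => B t w - B s w) @^-1` A) = normal_prob 0 (Num.sqrt (t - s)) A)
    &
      (forall (n : nat) (tt : 'I_n.+1 -> R),
         0 <= tt ord0 -> tt ord_max < T ->
         (forall i : 'I_n, tt (widen_ord (leqnSn n) i) < tt (lift ord0 i)) ->
         mutually_independent_rvs P
           (fun (i : 'I_n) w => B (tt (lift ord0 i)) w - B (tt (widen_ord (leqnSn n) i)) w))].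

(* X is a strong solution on [0,T) of
     dX_t = - alpha/(T-t) X_t dt + dB_t,  X_0 = 0,
   i.e. a process with continuous sample paths, each X_t a random variable, and
   almost surely, for all t in [0,T),
     X_t = - \int_0^t alpha/(T-u) X_u du + B_t.
   (The noise is additive, so no stochastic integral is needed.) *)
Definition alpha_Wiener_bridge d (Omega : measurableType d) (R : realType)
    (P : probability Omega R) (T alpha : R) (B X : R -> Omega -> R) : Prop :=
  [/\ (forall t, 0 <= t < T -> measurable_fun setT (X t)),
      (forall w, {within `[0, T[, continuous (fun t => X t w)}),
      {ae P, forall w, X 0 w = 0}
    & {ae P, forall w, forall t, 0 <= t < T ->
        X t w = - Rintegral lebesgue_measure `[0, t]
                    (fun u => alpha / (T - u) * X u w) + B t w}].

(* Main.v *)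
(** The time grid is geometric towards [T]: [T - t_k = T q^k] with [q = exp(-eta)].
    On it the scheme [Y_{k+1} = q^alpha Y_k + B_{t_{k+1}} - B_{t_k}]
    has constant coefficients, and the Riccati recursion obtained by integrating out the Gaussian
    increments one after the other is solved exactly by ratios of values of
    [h(r) = A exp(lam1 r) + A' exp(lam2 r)], where [lam1], [lam2] are the roots of
    [lam^2 + (2 alpha - 1) lam - 2 mu].  Hence, for suitable constants [c_n] and [p_n], the
    expectation of [exp(- c_n sum_k (t_{k+1} - t_k) Y_k^2 / (T - t_k)^2 - p_n Y_n^2)] does not
    depend on the number of steps: it is [h(-L)^(-1/2)].  As the mesh tends to [0],
    [c_n -> mu], [p_n -> nu], and [Y] converges pathwise to [X] by a discrete Gronwall estimate
    for the integral equation, so dominated convergence gives the formula. *)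

Require Import Defs.
From HB Require Import structures.
From mathcomp Require Import all_boot all_order all_algebra.
From mathcomp Require Import all_classical all_reals all_analysis.
From mathcomp Require Import measurable_realfun.
From mathcomp Require Import ring lra.
Set Implicit Arguments. Unset Strict Implicit. Unset Printing Implicit Defensive.
Import Order.TTheory GRing.Theory Num.Theory.
Import numFieldNormedType.Exports.
Local Open Scope classical_set_scope.
Local Open Scope ring_scope.

(** * Gaussian increments and independence *)

Section normal_expectation.
Context {R : realType}.
Local Notation leb := (@lebesgue_measure R).

(** The Radon-Nikodym derivative of the normal law and [normal_pdf] have the same integral over
    every measurable set, hence agree almost everywhere. The abstract change of variables thus
    becomes the one with the explicit density. *)
Lemma integral_normal_prob (m s : R) (f : R -> \bar R) :
  measurable_fun setT f ->
  (\int[normal_prob m s]_x `|f x| < +oo)%E ->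
  (\int[normal_prob m s]_x f x = \int[leb]_x (f x * (normal_pdf m s x)%:E))%E.
Proof.
move=> mf finf.
rewrite -(Radon_Nikodym_change_of_variables (normal_prob_dominates m s))//=;
  last by apply/integrableP; split.
apply: ae_eq_integral => //.
- apply: emeasurable_funM => //; apply: (measurable_int leb).
  by apply: Radon_Nikodym_integrable; exact: normal_prob_dominates.
- apply: emeasurable_funM => //=; apply/measurableT_comp => //=.
  exact: measurable_normal_pdf.
- apply: ae_eqe_mul2l => /=.
  rewrite Radon_NikodymE//=; first exact: normal_prob_dominates.
  move=> nmu; case: cid => /= h [h1 h2 h3].
  apply: integral_ae_eq => //=.
  + by apply/measurableT_comp => //; exact: measurable_normal_pdf.
  + by move=> E _ mE; rewrite -h3.
Qed.

(** Completing the square: with [q = 1 + 2 phi s^2], the exponential times the centred density is a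
    constant multiple of the normal density with mean [m' = - 2 phi b s^2 / q] and standard
    deviation [s' = s / sqrt q], whose mass is 1. *)
Lemma normal_prob_exp_sqr (s phi b : R) : 0 < s -> 0 <= phi ->
  (\int[normal_prob 0 s]_z (expR (- phi * (b + z) ^+ 2))%:E =
   ((Num.sqrt (1 + 2 * phi * s ^+ 2))^-1 *
    expR (- (phi / (1 + 2 * phi * s ^+ 2)) * b ^+ 2))%:E)%E.
Proof.
move=> s0 phi0.
have mf : measurable_fun setT (fun z => (expR (- phi * (b + z) ^+ 2))%:E).
  apply/measurable_EFinP/measurableT_comp => //.
  by apply: measurable_funM => //; apply: measurable_funX; exact: measurable_funD.
have q0 : 0 < 1 + 2 * phi * s ^+ 2.
  by apply: ltr_pwDl => //; apply: mulr_ge0; [apply: mulr_ge0|exact: sqr_ge0].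
rewrite integral_normal_prob//; last first.
  apply: (@le_lt_trans _ _ (\int[normal_prob 0 s]_x (cst 1 x)))%E.
    apply: ge0_le_integral => //=.
      apply/measurable_EFinP; apply: measurableT_comp; first exact: normr_measurable.
      exact/measurable_EFinP.
    move=> x _; rewrite lee_fin ger0_norm ?expR_ge0//.
    by rewrite -[leRHS]expR0 ler_expR mulNr oppr_le0 mulr_ge0// sqr_ge0.
  by rewrite integral_cst//= mul1e probability_setT ltry.
pose q := 1 + 2 * phi * s ^+ 2.
have sq0 : 0 < Num.sqrt q by rewrite sqrtr_gt0.
pose s' := s / Num.sqrt q.
have s'0 : s' != 0 by rewrite gt_eqF// divr_gt0.
pose m' := - (2 * phi * b * s ^+ 2 / q).
have E x : expR (- phi * (b + x) ^+ 2) * normal_pdf 0 s x =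
   ((Num.sqrt q)^-1 * expR (- (phi / q) * b ^+ 2)) * normal_pdf m' s' x.
  rewrite (normal_pdfE 0 (lt0r_neq0 s0)) (normal_pdfE m' s'0) /normal_peak /normal_fun.
  have -> : s' ^+ 2 * pi *+ 2 = (s ^+ 2 * pi *+ 2) / q.
    rewrite /s' expr_div_n sqr_sqrtr ?(ltW q0)//; field.
    by rewrite gt_eqF.
  have p0 : 0 <= s ^+ 2 * pi *+ 2.
    by apply: mulrn_wge0; apply: mulr_ge0; [exact: sqr_ge0|exact: pi_ge0].
  rewrite (sqrtrM _ p0).
  rewrite sqrtrV ?(ltW q0)// invfM invrK.
  rewrite [LHS]mulrCA -expRD.
  rewrite [RHS](_ : _ = (Num.sqrt (s ^+ 2 * pi *+ 2))^-1 *
     ((Num.sqrt q)^-1 * Num.sqrt q) *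
     (expR (- (phi / q) * b ^+ 2) * expR (- (x - m') ^+ 2 / (s' ^+ 2 *+ 2)))); last by ring.
  rewrite mulVf ?gt_eqF// mulr1 -expRD; congr (_ * expR _).
  rewrite /s' expr_div_n sqr_sqrtr ?(ltW q0)// /m' /q.
  by field; rewrite !gt_eqF.
transitivity (\int[leb]_x (((Num.sqrt q)^-1 * expR (- (phi / q) * b ^+ 2))%:E *
    (normal_pdf m' s' x)%:E))%E.
  by apply: eq_integral => x _; rewrite -!EFinM E.
rewrite integralZl//=; last exact: integrable_normal_pdf.
by rewrite integral_normal_pdf mule1.
Qed.

End normal_expectation.

(** * Independence and laws of pairs *)

Section independence.
Context d (Omega : measurableType d) (R : realType) (P : probability Omega R).
Context d' (E : measurableType d') d'' (F : measurableType d'').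

(** By uniqueness of the product measure, the product rule on rectangles identifies the joint law as
    the law of [U] times [Q]; Tonelli then gives the iterated integral. *)
Lemma integral_independent (U : Omega -> E) (Z : Omega -> F)
    (Q : probability F R) (f : E * F -> \bar R) :
  measurable_fun setT U -> measurable_fun setT Z ->
  (forall A C, measurable A -> measurable C ->
     P (U @^-1` A `&` Z @^-1` C) = (P (U @^-1` A) * Q C)%E) ->
  measurable_fun setT f -> (forall x, 0 <= f x)%E ->
  (\int[P]_w f (U w, Z w) = \int[P]_w \int[Q]_z f (U w, z))%E.
Proof.
move=> mU mZ UZ mf f0.
have mUZ : measurable_fun setT (fun w => (U w, Z w)) by exact: measurable_fun_pair.
pose mU' : {mfun _ >-> _} := HB.pack U (isMeasurableFun.Build _ _ _ _ _ mU).
pose mUZ' : {mfun _ >-> _} :=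
  HB.pack (fun w => (U w, Z w)) (isMeasurableFun.Build _ _ _ _ _ mUZ).
pose lawU : probability E R := distribution P mU'.
pose lawUZ : probability (E * F)%type R := distribution P mUZ'.
transitivity (\int[lawUZ]_x f x)%E.
  by rewrite (ge0_integral_pushforward mUZ).
transitivity (\int[lawU \x Q]_x f x)%E.
  apply: eq_measure_integral => /= W mW _.
  apply/esym/product_measure_unique => // A C mA mC; exact: UZ.
rewrite fubini_tonelli1//= (ge0_integral_pushforward mU)//.
  exact: measurable_fun_fubini_tonelli_F.
by move=> x _; apply: integral_ge0.
Qed.

(** As functions of [W], both sides are measures that agree on rectangles with the product of the
    law of [U] and [P G] times the law of [Z]. In the application [G] is an event about later
    increments, from which the merged pair stays independent. *)
Lemma independent_pair (U : Omega -> E) (Z : Omega -> F) (G : set Omega) :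
  measurable_fun setT U -> measurable_fun setT Z -> measurable G ->
  (forall A C, measurable A -> measurable C ->
     P (U @^-1` A `&` Z @^-1` C) = (P (U @^-1` A) * P (Z @^-1` C))%E) ->
  (forall A C, measurable A -> measurable C ->
     P (U @^-1` A `&` Z @^-1` C `&` G) =
     (P (U @^-1` A) * P (Z @^-1` C) * P G)%E) ->
  forall W, measurable W ->
  P ((fun w => (U w, Z w)) @^-1` W `&` G) =
  (P ((fun w => (U w, Z w)) @^-1` W) * P G)%E.
Proof.
move=> mU mZ mG UZ UZG W mW.
have mUZ : measurable_fun setT (fun w => (U w, Z w)) by exact: measurable_fun_pair.
pose U' : {mfun _ >-> _} := HB.pack U (isMeasurableFun.Build _ _ _ _ _ mU).
pose Z' : {mfun _ >-> _} := HB.pack Z (isMeasurableFun.Build _ _ _ _ _ mZ).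
pose UZ' : {mfun _ >-> _} :=
  HB.pack (fun w => (U w, Z w)) (isMeasurableFun.Build _ _ _ _ _ mUZ).
pose c : {nonneg R} := NngNum (fine_ge0 (measure_ge0 P G)).
have cE : (c%:num)%:E = P G by rewrite /= fineK// fin_num_measure.
pose m1 : {sigma_finite_measure set E -> \bar R} := distribution P U'.
pose m2 : {sigma_finite_measure set F -> \bar R} := mscale c (distribution P Z').
pose m3 : {measure set (E * F)%type -> \bar R} 
  := pushforward (mrestr P mG) UZ'.
pose m4 : {measure set (E * F)%type -> \bar R} := mscale c (distribution P UZ').
transitivity ((m1 \x m2)%E W).
  rewrite (@product_measure_unique _ _ _ _ _ m1 m2 (m3 mUZ))// => A C mA mC.
  rewrite -[RHS]/(P (U @^-1` A) * ((c%:num)%:E * P (Z @^-1` C)))%E cE.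
  by rewrite [(P G * _)%E]muleC muleA; exact: UZG.
rewrite muleC -cE.
rewrite (@product_measure_unique _ _ _ _ _ m1 m2 m4)// => A C mA mC.
rewrite -[RHS]/(P (U @^-1` A) * ((c%:num)%:E * P (Z @^-1` C)))%E muleCA.
by congr (_ * _)%E; exact: UZ.
Qed.

End independence.

(** * Linear Gaussian recursion with quadratic cost *)

Section gaussian_chain.
Context d (Omega : measurableType d) (R : realType) (P : probability Omega R).
Variables (n : nat) (Z : nat -> Omega -> R) (a : R) (w : nat -> R).
Hypothesis mZ : forall i, (i < n)%N -> measurable_fun setT (Z i).

Fixpoint chain (k : nat) (x : Omega) : R :=
  if k is j.+1 then a * chain j x + Z j x else 0.

Definition chain_cost (k : nat) (x : Omega) : R :=
  \sum_(i < k) w i * chain i x ^+ 2.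

Lemma measurable_chain k : (k <= n)%N -> measurable_fun setT (chain k).
Proof.
elim: k => [_|k IH kn]; first exact: measurable_cst.
rewrite -[chain k.+1]/(fun x => a * chain k x + Z k x).
apply: measurable_funD; last exact: mZ.
by apply: measurable_funM => //; exact: IH (ltnW kn).
Qed.

Lemma measurable_chain_cost k : (k <= n)%N -> measurable_fun setT (chain_cost k).
Proof.
move=> kn; apply: measurable_sum => i; apply: measurable_funM => //.
by apply/measurable_funX/measurable_chain/ltnW/(leq_trans (ltn_ord i)).
Qed.

(** Accumulated cost and position together are Markov: by [stateS] the next pair is a function of
    the present pair and the fresh increment. Independence from the future is therefore tracked for
    this pair alone. *)
Let state k x := (chain_cost k x, chain k x).

Let mstate k : (k <= n)%N -> measurable_fun setT (state k).
Proof.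
move=> kn; apply: measurable_fun_pair; first exact: measurable_chain_cost.
exact: measurable_chain.
Qed.

Let stateS k x : state k.+1 x =
  ((state k x).1 + w k * (state k x).2 ^+ 2, a * (state k x).2 + Z k x).
Proof. by rewrite /state /chain_cost big_ord_recr. Qed.

Hypothesis indepZ : mutually_independent_rvs P (fun i : 'I_n => Z i).

Let tail k (C : nat -> set R) := \big[setI/setT]_(k <= i < n) (Z i @^-1` C i).

Let mtail k C : (forall i, measurable (C i)) -> measurable (tail k C).
Proof.
move=> mC; rewrite /tail big_nat_cond.
apply: (big_ind (fun A : set Omega => measurable A)) => //.
- by move=> A B; exact: measurableI.
- by move=> i /andP[/andP[_ ilt] _]; rewrite -[X in measurable X]setTI; exact: mZ.
Qed.

(** The independence hypothesis speaks of all [n] increments at once. Induction on [k] moves them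
    one by one into the state, with [independent_pair] applied to the state, [Z k] and the event
    [tail k.+1 C]; replacing some [C i] by the whole line gives the product rules for fewer
    increments. *)
Let state_tail k (C : nat -> set R) A : (k <= n)%N ->
  (forall i, measurable (C i)) -> measurable A ->
  P (state k @^-1` A `&` tail k C) =
  (P (state k @^-1` A) * \prod_(k <= i < n) P (Z i @^-1` C i))%E.
Proof.
elim: k C A => [|k IH] C A kn mC mA.
  (* The initial state is the constant [(0, 0)], so its preimages are everything or nothing. *)
  have [A0|A0] := pselect (A (0, 0)).
    have -> : state 0 @^-1` A = setT.
      by apply/seteqP; split => // x _; rewrite /preimage /state /chain_cost/= big_ord0.
    rewrite setTI probability_setT mul1e /tail !big_mkord.
    exact: indepZ.
  have -> : state 0 @^-1` A = set0.
    by apply/seteqP; split => // x; rewrite /preimage /state /chain_cost/= big_ord0.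
  by rewrite set0I measure0 mul0e.
have Ptail : P (tail k.+1 C) = (\prod_(k.+1 <= i < n) P (Z i @^-1` C i))%E.
  pose C' i := if (i <= k)%N then setT else C i.
  have mC' i : measurable (C' i) by rewrite /C'; case: ifP.
  have := IH C' setT (ltnW kn) mC' measurableT.
  rewrite preimage_setT setTI probability_setT mul1e /tail.
  rewrite !(big_ltn kn) {1 3}/C' leqnn preimage_setT setTI probability_setT mul1e.
  rewrite [in LHS]big_nat_cond [in RHS]big_nat_cond.
  under eq_bigr => i /andP[/andP[ki _] _] do rewrite /C' leqNgt ki/=.
  under [in RHS]eq_bigr => i /andP[/andP[ki _] _] do rewrite /C' leqNgt ki/=.
  by rewrite -!big_nat_cond.
(* The transition map of the state; it turns an event on the next state into an event on the present
   state and [Z k]. *)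
pose psi (u : (R * R) * R) := (u.1.1 + w k * u.1.2 ^+ 2, a * u.1.2 + u.2).
have mpsi : measurable_fun setT psi.
  apply: measurable_fun_pair.
    apply: measurable_funD; first by apply: measurableT_comp.
    apply: measurable_funM => //; apply: measurable_funX.
    by apply: measurableT_comp.
  apply: measurable_funD => //; apply: measurable_funM => //.
  by apply: measurableT_comp.
have -> : state k.+1 @^-1` A = (fun x => (state k x, Z k x)) @^-1` (psi @^-1` A).
  by apply/seteqP; split => x; rewrite /preimage/= stateS.
have mk := mstate (ltnW kn).
rewrite (@independent_pair _ _ _ P _ _ _ _ _ _ _ mk (mZ kn) (mtail k.+1 mC)) ?Ptail//.
- move=> A' C' mA' mC'.
  pose C2 i := if i == k then C' else setT.
  have mC2 i : measurable (C2 i) by rewrite /C2; case: ifP.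
  have := IH C2 A' (ltnW kn) mC2 mA'.
  rewrite /tail !(big_ltn kn) {1 3}/C2 eqxx.
  rewrite [in LHS]big_nat_cond [in RHS]big_nat_cond.
  rewrite big1 ?setIT; last first.
    by move=> i /andP[/andP[ki _] _]; rewrite /C2 gtn_eqF// preimage_setT.
  rewrite big1 ?mule1//.
  by move=> i /andP[/andP[ki _] _]; rewrite /C2 gtn_eqF// preimage_setT probability_setT.
- move=> A' C' mA' mC'.
  pose C2 i := if i == k then C' else C i.
  have mC2 i : measurable (C2 i) by rewrite /C2; case: ifP.
  have := IH C2 A' (ltnW kn) mC2 mA'.
  rewrite /tail !(big_ltn kn) {1 3}/C2 eqxx setIA -muleA.
  rewrite [in LHS]big_nat_cond [in RHS]big_nat_cond.
  under eq_bigr => i /andP[/andP[ki _] _] do rewrite /C2 gtn_eqF//.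
  under [in RHS]eq_bigr => i /andP[/andP[ki _] _] do rewrite /C2 gtn_eqF//.
  by rewrite -!big_nat_cond.
- by rewrite -[X in measurable X]setTI; exact: mpsi.
Qed.

Let state_indep k (A : set (R * R)) (C : set R) : (k < n)%N -> measurable A -> measurable C ->
  P (state k @^-1` A `&` Z k @^-1` C) = (P (state k @^-1` A) * P (Z k @^-1` C))%E.
Proof.
move=> kn mA mC.
pose C2 i := if i == k then C else setT.
have mC2 i : measurable (C2 i) by rewrite /C2; case: ifP.
have := state_tail (ltnW kn) mC2 mA.
rewrite /tail !(big_ltn kn) {1 3}/C2 eqxx.
rewrite [in LHS]big_nat_cond [in RHS]big_nat_cond.
rewrite big1 ?setIT; last first.
  by move=> i /andP[/andP[ki _] _]; rewrite /C2 gtn_eqF// preimage_setT.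
rewrite big1 ?mule1//.
by move=> i /andP[/andP[ki _] _]; rewrite /C2 gtn_eqF// preimage_setT probability_setT.
Qed.

Variables (s phi : nat -> R).
Hypothesis s_gt0 : forall i, (i < n)%N -> 0 < s i.
Hypothesis lawZ : forall i, (i < n)%N -> forall C, measurable C ->
  P (Z i @^-1` C) = normal_prob 0 (s i) C.
Hypothesis phi_ge0 : forall i, (i <= n)%N -> 0 <= phi i.
Hypothesis phiE : forall i, (i < n)%N ->
  phi i = w i + phi i.+1 * a ^+ 2 / (1 + 2 * phi i.+1 * s i ^+ 2).

Let V k x := expR (- chain_cost k x - phi k * chain k x ^+ 2).

(* Integrating out the last increment is one step of the Riccati recursion [phiE]. *)
Let integral_step k : (k < n)%N ->
  (\int[P]_x (V k.+1 x)%:E =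
   ((Num.sqrt (1 + 2 * phi k.+1 * s k ^+ 2))^-1)%:E * \int[P]_x (V k x)%:E)%E.
Proof.
move=> kn.
pose f (u : (R * R) * R) : \bar R :=
  (expR (- (u.1.1 + w k * u.1.2 ^+ 2) - phi k.+1 * (a * u.1.2 + u.2) ^+ 2))%:E.
have mf : measurable_fun setT f.
  apply/measurable_EFinP/measurableT_comp => //.
  apply: measurable_funB.
    apply: measurableT_comp => //; apply: measurable_funD.
      by apply: measurableT_comp.
    apply: measurable_funM => //; apply: measurable_funX.
    by apply: measurableT_comp.
  apply: measurable_funM => //; apply: measurable_funX.
  apply: measurable_funD => //; apply: measurable_funM => //.
  by apply: measurableT_comp.
transitivity (\int[P]_x f (state k x, Z k x))%E.
  apply: eq_integral => x _; rewrite /f /V; congr (expR _)%:E.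
  by rewrite -[chain_cost k.+1 x]/((state k.+1 x).1) stateS.
pose Q : probability (measurableTypeR R) R := normal_prob 0 (s k).
rewrite (@integral_independent _ _ _ P _ _ _ (measurableTypeR R) (state k) (Z k) Q)//; first last.
- by move=> x; rewrite lee_fin expR_ge0.
- by move=> A C mA mC; rewrite state_indep// lawZ.
- exact: mZ.
- exact: mstate (ltnW kn).
rewrite -ge0_integralZl//; last 2 first.
- apply/measurable_EFinP/measurableT_comp => //.
  apply: measurable_funB.
    by apply: measurableT_comp => //; exact: measurable_chain_cost (ltnW kn).
  apply: measurable_funM => //; apply: measurable_funX.
  exact: measurable_chain (ltnW kn).
- by move=> x _; rewrite lee_fin expR_ge0.
apply: eq_integral => x _.
transitivity (\int[normal_prob 0 (s k)]_z
    ((expR (- (chain_cost k x + w k * chain k x ^+ 2)))%:E *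
     (expR (- phi k.+1 * (a * chain k x + z) ^+ 2))%:E))%E.
  by apply: eq_integral => z _; rewrite /f /= -EFinM -expRD mulNr.
rewrite ge0_integralZl//; last first.
  apply/measurable_EFinP/measurableT_comp => //.
  by apply: measurable_funM => //; apply: measurable_funX; exact: measurable_funD.
rewrite normal_prob_exp_sqr ?s_gt0 ?phi_ge0// -!EFinM; congr (_%:E).
rewrite mulrCA -expRD /V (phiE kn); congr (_ * expR _).
by ring.
Qed.

(** Since the chain starts at 0 without cost, [V 0] is identically 1. What remains are the
    normalising factors left by the increments, integrated out from the last to the first. *)
Lemma gaussian_chain_expectation :
  (\int[P]_x (expR (- chain_cost n x - phi n * chain n x ^+ 2))%:E =
   (\prod_(i < n) (Num.sqrt (1 + 2 * phi i.+1 * s i ^+ 2))^-1)%:E)%E.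
Proof.
suff H k : (k <= n)%N ->
    (\int[P]_x (V k x)%:E =
     (\prod_(i < k) (Num.sqrt (1 + 2 * phi i.+1 * s i ^+ 2))^-1)%:E)%E by exact: H.
elim: k => [_|k IH kn].
  rewrite big_ord0 /V /chain_cost/=.
  under eq_integral do rewrite big_ord0 oppr0 expr0n/= mulr0 subr0 expR0.
  by rewrite integral_cst// mul1e; exact: probability_setT.
by rewrite integral_step// IH ?(ltnW kn)// big_ord_recr/= -EFinM mulrC.
Qed.

End gaussian_chain.

(** * Riemann sums and the Euler scheme on a geometric grid *)

Section segment.
Context {R : realType}.
Implicit Types f : R -> R.

Lemma within_segment_continuousP f (a b : R) :
  {within `[a, b], continuous f} ->
  forall x : R, a <= x <= b -> forall e : R, 0 < e -> exists2 d : R, 0 < d &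
    forall y, a <= y <= b -> `|x - y| < d -> `|f x - f y| < e.
Proof.
move=> cf x xab e e0.
have xA : `[a, b]%classic x by rewrite /= in_itv.
move/subspace_continuousP : cf => /(_ x xA)/cvgrPdist_lt/(_ e e0).
rewrite /within /= => /nbhs_ballP[d /= d0 xd].
by exists d => // y yab xyd; apply: (xd y) => //; rewrite in_itv.
Qed.

(** Heine-Cantor through the near-covering form of compactness: around each point half of its
    modulus radius serves all nearby points, and compactness makes one small [d] serve the whole
    segment. *)
Lemma segment_uniform_continuous f (a b : R) :
  {within `[a, b], continuous f} ->
  forall e : R, 0 < e -> exists2 d : R, 0 < d & forall x y, a <= x <= b -> a <= y <= b ->
    `|x - y| < d -> `|f x - f y| < e.
Proof.
move=> cf e e0.
have := (@segment_compact R a b) => /compact_near_coveringP.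
move=> /(_ R (0^'+)
  (fun d x => a <= x <= b -> forall y, a <= y <= b -> `|x - y| < d -> `|f x - f y| < e)).
have cov : forall x, `[a, b]%classic x -> \forall x' \near x & d \near 0^'+,
    a <= x' <= b -> forall y, a <= y <= b -> `|x' - y| < d -> `|f x' - f y| < e.
  move=> x; rewrite /= in_itv/= => xab.
  have [d d0 xd] := within_segment_continuousP cf xab (divr_gt0 e0 (ltr0n _ 2)).
  have d20 : 0 < d / 2 by rewrite divr_gt0.
  exists (ball x (d / 2), [set r | r < d / 2]).
    by split; [exact: nbhsx_ballx|exact: nbhs_right_lt].
  move=> [x' r] /= [xx' rd] x'ab y yab x'y.
  rewrite [e]splitr.
  have fx' : `|f x - f x'| < e / 2.
    by apply: xd => //; apply: lt_trans xx' _; rewrite ltr_pdivrMr// ltr_pMr// ltr1n.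
  have fy : `|f x - f y| < e / 2.
    apply: xd => //; rewrite [d]splitr.
    apply: (le_lt_trans (ler_distD x' x y)); apply: ltrD => //.
    exact: lt_trans x'y rd.
  apply: (le_lt_trans (ler_distD (f x) _ _)); apply: ltrD => //.
  by rewrite distrC.
move=> /(_ (at_right_proper_filter _) cov) H.
have [d [d0 Hd]] : exists d : R, 0 < d /\
    `[a, b] `<=` (fun x => a <= x <= b -> forall y, a <= y <= b ->
       `|x - y| < d -> `|f x - f y| < e).
  near (0 : R)^'+ => d; exists d; split => //.
  by near: d; exact: H.
by exists d => // x y xab yab; apply: Hd.
Unshelve. all: by end_near. Qed.

Lemma segment_bounded f (a b : R) : a <= b -> {within `[a, b], continuous f} ->
  exists2 M : R, 0 <= M & forall x : R, a <= x <= b -> `|f x| <= M.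
Proof.
move=> ab cf.
have [c1 _ c1M] := EVT_max ab cf; have [c2 _ c2m] := EVT_min ab cf.
exists (Num.max `|f c1| `|f c2|); first by rewrite le_max normr_ge0.
move=> x xab.
have xI : x \in `[a, b]%R by rewrite in_itv.
rewrite ler_norml -lerNl; apply/andP; split.
  rewrite lerNl (le_trans _ (c2m x xI))// lerNl le_max; apply/orP; right.
  by rewrite -normrN ler_norm.
by rewrite (le_trans (c1M x xI))// le_max ler_norm.
Qed.

(** The increment of the primitive is the integral over [[a, b]], compared there with the integral
    of the constant [c]. Continuity is asked on [[0, T[] because the integrands to come carry powers
    of [1 / (T - u)]. *)
Lemma Rintegral_increment f (T a b c e : R) :
  {within `[0, T[, continuous f} -> 0 <= a -> a <= b -> b < T ->
  (forall u, a <= u <= b -> `|f u - c| <= e) ->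
  `|Rintegral lebesgue_measure `[0, b] f - Rintegral lebesgue_measure `[0, a] f
    - c * (b - a)| <= e * (b - a).
Proof.
move=> cf a0 ab bT fc.
have ib : lebesgue_measure.-integrable `[0, b] (EFin \o f).
  apply: continuous_compact_integrable; first exact: segment_compact.
  apply: continuous_subspaceW cf => x /=; rewrite !in_itv/= => /andP[-> xb].
  exact: le_lt_trans xb bT.
have iab : lebesgue_measure.-integrable `[a, b] (EFin \o f).
  apply: integrableS ib => // x /=; rewrite !in_itv/= => /andP[ax ->].
  by rewrite (le_trans a0 ax).
have ioab : lebesgue_measure.-integrable `]a, b] (EFin \o f).
  by apply: integrableS iab => //; apply: subset_itvr; rewrite bnd_simp.
rewrite Rintegral_itvB ?bnd_simp// Rintegral_itv_obnd_cbnd//.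
have muab : fine (lebesgue_measure `[a, b]) = b - a.
  rewrite lebesgue_measure_itv/= lte_fin; case: ltP => //= ba.
  by rewrite (le_anti (introT andP (conj ab ba))) subrr.
have icst r : lebesgue_measure.-integrable `[a, b] (EFin \o cst r).
  apply: continuous_compact_integrable; first exact: segment_compact.
  by move=> x; exact: cvg_cst.
have cE r : r * (b - a) = Rintegral lebesgue_measure `[a, b] (cst r).
  by rewrite Rintegral_cst// muab.
rewrite !cE -RintegralB//; last exact: icst.
have iB : lebesgue_measure.-integrable `[a, b] (EFin \o (fun x => f x - cst c x)).
  have mab : measurable (`[a, b]%classic : set (measurableTypeR R)) by [].
  exact: (integrableB mab iab (icst c)).
apply: (le_trans (le_normr_Rintegral _ iB)) => //.
apply: le_Rintegral => //; [exact: (integrable_norm iB)|exact: icst].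
Qed.

End segment.

(** * The geometric grid and its Riemann sums *)

Section geometric_grid.
Context {R : realType}.
Variables (T t l : R).
Hypotheses (T_gt0 : 0 < T) (l_gt0 : 0 < l) (TlE : T * expR (- l) = T - t).

(** The grid of index [n] has [n.+1] steps, so the divisor is never zero and the last node is
    [grid n n.+1 = t]. *)
Definition step (n : nat) : R := l / n.+1%:R.
Definition remaining (n k : nat) : R := T * expR (- (k%:R * step n)).
Definition grid (n k : nat) : R := T - remaining n k.
Definition mesh (n k : nat) : R := grid n k.+1 - grid n k.

Lemma step_gt0 n : 0 < step n. Proof. by rewrite divr_gt0. Qed.

Lemma stepE n : n.+1%:R * step n = l.
Proof. by rewrite /step mulrC divfK. Qed.

Lemma cvg_step : step n @[n --> \oo] --> 0.
Proof.
rewrite -(mulr0 l); apply: cvgM; first exact: cvg_cst.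
exact: cvg_harmonic.
Qed.

Lemma remaining_gt0 n k : 0 < remaining n k.
Proof. by rewrite mulr_gt0// expR_gt0. Qed.

Lemma remainingS n k : remaining n k.+1 = remaining n k * expR (- step n).
Proof. by rewrite /remaining -mulrA -expRD; congr (_ * expR _); rewrite -natr1; ring. Qed.

Lemma meshE n k : mesh n k = remaining n k * (1 - expR (- step n)).
Proof. by rewrite /mesh /grid remainingS; ring. Qed.

Lemma expNstep_lt1 n : expR (- step n) < 1.
Proof. by rewrite expR_lt1 oppr_lt0 step_gt0. Qed.

Lemma mesh_gt0 n k : 0 < mesh n k.
Proof. by rewrite meshE mulr_gt0 ?remaining_gt0// subr_gt0 expNstep_lt1. Qed.

Lemma grid_lt n k : grid n k < grid n k.+1.
Proof. by rewrite -subr_gt0; exact: mesh_gt0. Qed.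

Lemma grid_le n : {homo grid n : k m / (k <= m)%N >-> k <= m}.
Proof. by apply: homo_leq => // [x y z|k]; [exact: le_trans|exact/ltW/grid_lt]. Qed.

Lemma grid0 n : grid n 0 = 0.
Proof. by rewrite /grid /remaining mul0r oppr0 expR0 mulr1 subrr. Qed.

Lemma grid_last n : grid n n.+1 = t.
Proof. by rewrite /grid /remaining stepE TlE; ring. Qed.

Lemma grid_ge0 n k : 0 <= grid n k.
Proof. by rewrite -(grid0 n); exact: grid_le. Qed.

Lemma grid_le_last n k : (k <= n.+1)%N -> grid n k <= t.
Proof. by move=> kn; rewrite -(grid_last n); exact: grid_le. Qed.

Lemma grid_itv n k : (k <= n.+1)%N -> 0 <= grid n k <= t.
Proof. by move=> kn; rewrite grid_ge0 grid_le_last. Qed.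

Lemma t_lt_T : t < T.
Proof. by rewrite -subr_gt0 -TlE mulr_gt0// expR_gt0. Qed.

Lemma t_gt0 : 0 < t.
Proof. by rewrite -(grid_last 0) (le_lt_trans (grid_ge0 0 0))// grid_lt. Qed.

Lemma remaining_ge n k : (k <= n.+1)%N -> T - t <= remaining n k.
Proof. by move=> /grid_le_last; rewrite /grid lerBlDl -lerBlDr. Qed.

Lemma mesh_le n k : mesh n k <= T * step n.
Proof.
rewrite meshE; apply: ler_pM.
- exact/ltW/remaining_gt0.
- by rewrite subr_ge0 ltW// expNstep_lt1.
- by rewrite /remaining ger_pMr// expR_le1 oppr_le0 mulr_ge0// ltW// step_gt0.
- by rewrite lerBlDr -lerBlDl; exact: expR_ge1Dx.
Qed.

Lemma sum_mesh n k : \sum_(i < k) mesh n i = grid n k.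
Proof.
elim: k => [|k IH]; first by rewrite big_ord0 grid0.
by rewrite big_ord_recr/= IH /mesh; ring.
Qed.

Lemma near_mesh_lt (d : R) : 0 < d ->
  \forall n \near \oo, forall k, mesh n k < d.
Proof.
move=> d0.
have c : T * step n @[n --> \oo] --> 0.
  by rewrite -(mulr0 T); apply: cvgM; [exact: cvg_cst|exact: cvg_step].
move/cvgrPdist_lt : c => /(_ d d0); apply: filterS => n.
rewrite sub0r normrN => nd k.
by apply: le_lt_trans (mesh_le n k) (le_lt_trans (ler_norm _) nd).
Qed.

Lemma grid_oscillation (f : R -> R) : {within `[0, T[, continuous f} ->
  forall e : R, 0 < e -> \forall n \near \oo, forall k, (k <= n)%N ->
  forall u, grid n k <= u <= grid n k.+1 -> `|f u - f (grid n k)| <= e.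
Proof.
move=> cf e e0.
have cft : {within `[0, t], continuous f}.
  apply: continuous_subspaceW cf => x /=; rewrite !in_itv/= => /andP[-> xt].
  exact: le_lt_trans xt t_lt_T.
have [d d0 fd] := segment_uniform_continuous cft e0.
have := near_mesh_lt d0; apply: filterS => n nd k kn u /andP[ku uk].
apply/ltW/fd.
- by rewrite (le_trans (grid_ge0 n k) ku) (le_trans uk)// grid_le_last.
- by rewrite grid_itv// ltnW.
- by rewrite ger0_norm ?subr_ge0// (le_lt_trans _ (nd k))// lerB.
Qed.

(** The sampled values are allowed a uniformly vanishing error, so that the values of the scheme can
    stand in for those of the path. *)
Lemma cvg_riemann_sum (f : R -> R) (y : nat -> nat -> R) :
  {within `[0, T[, continuous f} ->
  (forall e : R, 0 < e -> \forall n \near \oo, forall k, (k <= n)%N ->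
     `|y n k - f (grid n k)| <= e) ->
  \sum_(k < n.+1) mesh n k * y n k @[n --> \oo] -->
  Rintegral lebesgue_measure `[0, t] f.
Proof.
move=> cf yf; apply/cvgrPdist_le => e e0.
(* The oscillation of [f] on a cell and the error of [y] each get [e / (2 * t)] per unit of time;
   over the length [t] they add up to [e]. *)
have e'0 : 0 < e / (2 * t) by rewrite divr_gt0// mulr_gt0// t_gt0.
near=> n.
pose I k := Rintegral lebesgue_measure `[0, grid n k] f.
have IE : Rintegral lebesgue_measure `[0, t] f = \sum_(k < n.+1) (I k.+1 - I k).
  rewrite -(big_mkord xpredT (fun k => I k.+1 - I k)) telescope_sumr//.
  by rewrite /I grid_last grid0 set_itv1 Rintegral_set1 subr0.
rewrite IE -sumrB; apply: (le_trans (ler_norm_sum _ _ _)).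
apply: (@le_trans _ _ (\sum_(k < n.+1) (e / (2 * t) + e / (2 * t)) * mesh n k)).
  apply: ler_sum => k _.
  have kn : (k <= n)%N by rewrite -ltnS.
  have alg (A c m z : R) : A - m * z = (A - c * m) - (z - c) * m by ring.
  rewrite (alg _ (f (grid n k))).
  apply: (le_trans (ler_normB _ _)); rewrite [leRHS]mulrDl; apply: lerD.
    apply: (Rintegral_increment cf (grid_ge0 n k) (ltW (grid_lt n k))).
      by rewrite (le_lt_trans _ t_lt_T)// grid_le_last.
    by move: (k : nat) kn; near: n; exact: grid_oscillation.
  rewrite normrM (gtr0_norm (mesh_gt0 n k)); apply: ler_wpM2r.
    exact/ltW/mesh_gt0.
  by move: (k : nat) kn; near: n; exact: yf.
rewrite -mulr_sumr sum_mesh grid_last.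
rewrite le_eqVlt; apply/orP; left; apply/eqP.
by field; rewrite gt_eqF// t_gt0.
Unshelve. all: by end_near. Qed.

(** The quotient is squeezed between [c] and [c * expR (c * step n)]; both bounds come from
    [1 + x <= expR x], at [c * step n] and at its opposite. *)
Lemma cvg_expR_step_quot (c : R) :
  (expR (c * step n) - 1) / step n @[n --> \oo] --> c.
Proof.
apply: (squeeze_cvgr (f := fun=> c) (h := fun n => c * expR (c * step n))).
- near=> n; rewrite ler_pdivlMr ?step_gt0// ler_pdivrMr ?step_gt0//.
  apply/andP; split; first by rewrite lerBrDl; exact: expR_ge1Dx.
  have := expR_ge1Dx (- (c * step n)).
  rewrite -(ler_pM2r (expR_gt0 (c * step n))) -expRD addNr expR0.
  by rewrite mulrDl mul1r; lra.
- exact: cvg_cst.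
- rewrite -[X in _ --> X]mulr1; apply: cvgM; first exact: cvg_cst.
  rewrite -expR0; apply: continuous_cvg; first exact: continuous_expR.
  by rewrite -(mulr0 c); apply: cvgM; [exact: cvg_cst|exact: cvg_step].
Unshelve. all: by end_near. Qed.

End geometric_grid.

(** * Pathwise convergence of the Euler scheme *)

Section euler_scheme.
Context {R : realType}.
Variables (T t l : R).
Hypotheses (T_gt0 : 0 < T) (l_gt0 : 0 < l) (TlE : T * expR (- l) = T - t).
Local Notation step := (step l).
Local Notation remaining := (remaining T l).
Local Notation grid := (grid T l).
Local Notation mesh := (mesh T l).

Lemma within_continuous_div_remaining (x : R -> R) :
  {within `[0, T[, continuous x} ->
  {within `[0, T[, continuous (fun u => x u / (T - u))}.
Proof.
move=> /subspace_continuousP cx; apply/subspace_continuousP => u uT.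
apply: cvgM; first exact: cx.
apply: cvgV.
  by move: uT; rewrite /= in_itv/= => /andP[_ uT]; rewrite subr_eq0 gt_eqF.
by apply: cvgB; [exact: cvg_cst|exact: cvg_within].
Qed.

(** For [c = alpha] this quotient is the drift coefficient that the scheme effectively uses: the
    fraction of the position lost in one step over the fraction of the remaining time used up. *)
Lemma cvg_decay_quot (c : R) :
  (1 - expR (- (c * step n))) / (1 - expR (- step n)) @[n --> \oo] --> c.
Proof.
have H := cvg_expR_step_quot l_gt0.
have -> : (fun n => (1 - expR (- (c * step n))) / (1 - expR (- step n))) =
    (fun n => ((expR ((- c) * step n) - 1) / step n) *
              ((expR ((- 1) * step n) - 1) / step n)^-1).
  apply/funext => n; rewrite !mulNr mul1r.
  have s0 : step n != 0 by rewrite gt_eqF// step_gt0.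
  have q0 : expR (- step n) - 1 != 0 by rewrite subr_eq0 lt_eqF// expNstep_lt1.
  have q1 : 1 - expR (- step n) != 0 by rewrite -opprB oppr_eq0.
  by field; rewrite s0 q0 q1.
have {2}-> : c = (- c) * (- 1)^-1 by rewrite invrN1 mulrN1 opprK.
apply: cvgM; first exact: H.
by apply: cvgV; [rewrite oppr_eq0 oner_eq0|exact: H].
Qed.

Section convergence.
Variables (alpha : R) (x b : R -> R) (y : nat -> nat -> R).
Hypothesis cx : {within `[0, T[, continuous x}.
Hypothesis x0 : x 0 = 0.
Hypothesis xE : forall s : R, 0 <= s < T ->
  x s = - Rintegral lebesgue_measure `[0, s] (fun u => alpha / (T - u) * x u) + b s.
Hypothesis y0 : forall n, y n 0 = 0.
Hypothesis yS : forall n k,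
  y n k.+1 = expR (- (alpha * step n)) * y n k + (b (grid n k.+1) - b (grid n k)).

Let g u := x u / (T - u).
Let cg : {within `[0, T[, continuous g} := within_continuous_div_remaining cx.
Let f u := alpha / (T - u) * x u.

Let fE u : f u = alpha * g u.
Proof. by rewrite /f /g mulrAC mulrA. Qed.

Let cf : {within `[0, T[, continuous f}.
Proof.
move/subspace_continuousP : (cg) => cg'; apply/subspace_continuousP => u uT.
rewrite (_ : f = fun u => alpha * g u); last by apply/funext => v; rewrite fE.
by apply: cvgM; [exact: cvg_cst|exact: cg'].
Qed.

Let gT n k : g (grid n k) * remaining n k = x (grid n k).
Proof.
rewrite /g (_ : T - grid n k = remaining n k) ?divfK ?gt_eqF ?remaining_gt0//.
by rewrite /grid opprB addrCA subrr addr0.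
Qed.

(** Discrete Gronwall argument for a single path. One step commits an error of at most
    [ep * (1 + M) * mesh n k], where [ep] bounds both the oscillation of the drift and the distance
    from [rho] to [alpha], and [M] bounds [x u / (T - u)]. Errors grow by at most [A] per step,
    hence by at most [K] in total. *)
Lemma euler_scheme_cvg (e : R) : 0 < e ->
  \forall n \near \oo, forall k, (k <= n.+1)%N -> `|y n k - x (grid n k)| <= e.
Proof.
move=> e0.
have tT := t_lt_T T_gt0 TlE.
have t0 := t_gt0 T_gt0 l_gt0 TlE.
have cgt : {within `[0, t], continuous g}.
  apply: continuous_subspaceW cg => u /=; rewrite !in_itv/= => /andP[-> ut].
  exact: le_lt_trans ut tT.
have [M M0 gM] := segment_bounded (ltW t0) cgt.
pose K := expR (`|alpha| * l).
(* Chosen so that the final bound [K * (ep * (1 + M) * t)] equals [e]. *)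
pose ep := e / ((1 + M) * t * K).
have K0 : 0 < K by exact: expR_gt0.
have M1 : 0 < 1 + M by rewrite ltr_pwDl.
have ep0 : 0 < ep by rewrite divr_gt0// !mulr_gt0.
near=> n.
pose a := expR (- (alpha * step n)).
(* The true multiplier [a] can lie on either side of 1; its majorant [A] is at least 1, so new
   errors may also be multiplied by powers of [A]. *)
pose A := expR (`|alpha| * step n).
pose rho := (1 - a) / (1 - expR (- step n)).
have rho_close : `|rho - alpha| <= ep.
  rewrite /rho /a distrC; near: n.
  by move/cvgrPdist_le : (@cvg_decay_quot alpha) => /(_ ep ep0).
have osc : forall k, (k <= n)%N ->
    forall u, grid n k <= u <= grid n k.+1 -> `|f u - f (grid n k)| <= ep.
  by near: n; exact: (grid_oscillation T_gt0 l_gt0 TlE).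
have q1 : 0 < 1 - expR (- step n) by rewrite subr_gt0 expNstep_lt1.
have aA : a <= A.
  rewrite ler_expR -mulNr ler_pM2r ?step_gt0// -normrN; exact: ler_norm.
have A1 : 1 <= A by rewrite -[leLHS]expR0 ler_expR mulr_ge0// ltW// step_gt0.
pose I k := Rintegral lebesgue_measure `[0, grid n k] f.
have local_error k : (k <= n)%N ->
    `|I k.+1 - I k - (1 - a) * x (grid n k)| <= ep * (1 + M) * mesh n k.
  move=> kn.
  have kT : grid n k.+1 < T by rewrite (le_lt_trans _ tT)// grid_le_last.
  have m0 := mesh_gt0 T_gt0 l_gt0 n k.
  have -> : (1 - a) * x (grid n k) = rho * g (grid n k) * mesh n k.
    have <- : rho * (1 - expR (- step n)) = 1 - a by rewrite divfK// gt_eqF.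
    by rewrite -gT meshE; move: (rho) => r; ring.
  have alg (J r c m : R) : J - r * c * m = (J - alpha * c * m) - (r - alpha) * (c * m).
    by ring.
  rewrite alg; apply: (le_trans (ler_normB _ _)).
  have -> : ep * (1 + M) * mesh n k = ep * mesh n k + ep * (M * mesh n k) by ring.
  apply: lerD.
    rewrite -fE; apply: (Rintegral_increment cf) => //.
    - exact: grid_ge0.
    - exact/ltW/grid_lt.
    - exact: osc.
  rewrite !normrM (gtr0_norm m0); apply: ler_pM => //.
    by rewrite mulr_ge0// ltW.
  apply: ler_wpM2r; first exact: ltW.
  by rewrite -normrM; apply: gM; apply: (grid_itv T_gt0 l_gt0 TlE); exact: leqW.
have bound k : (k <= n.+1)%N ->
    `|y n k - x (grid n k)| <= A ^+ k * (ep * (1 + M) * grid n k).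
  elim: k => [_|k IH kn]; first by rewrite y0 grid0 x0 subrr normr0 !mulr0.
  have kn' : (k <= n.+1)%N := ltnW kn.
  have kT j : (j <= n.+1)%N -> 0 <= grid n j < T.
    by move=> jn; rewrite grid_ge0//= (le_lt_trans _ tT)// grid_le_last.
  (* The scheme and the integral equation are driven by the same increment of [b], which cancels in
     the difference. *)
  have -> : y n k.+1 - x (grid n k.+1) =
      a * (y n k - x (grid n k)) + (I k.+1 - I k - (1 - a) * x (grid n k)).
    have xk1 : x (grid n k.+1) = - I k.+1 + b (grid n k.+1) by rewrite xE// kT.
    have xk : x (grid n k) = - I k + b (grid n k) by rewrite xE// kT.
    rewrite yS -/a xk1; move: (I k.+1) (I k) xk => I1 I0 xk.
    have -> : b (grid n k) = x (grid n k) + I0 by rewrite xk; ring.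
    by ring.
  apply: (le_trans (ler_normD _ _)).
  have -> : grid n k.+1 = grid n k + mesh n k by rewrite /mesh addrC subrK.
  rewrite [X in A ^+ k.+1 * X]mulrDr [leRHS]mulrDr; apply: lerD.
    rewrite normrM (gtr0_norm (expR_gt0 _)) exprS -mulrA; apply: ler_pM => //.
    exact: IH.
  apply: (le_trans (local_error k _)) => //.
  apply: ler_peMl; last exact: exprn_ege1.
  by apply: mulr_ge0; [apply: mulr_ge0; exact: ltW|exact/ltW/mesh_gt0].
move=> k kn; apply: (le_trans (bound k kn)).
have -> : e = K * (ep * (1 + M) * t).
  by rewrite /ep; field; rewrite !gt_eqF.
apply: ler_pM.
- by rewrite exprn_ge0// expR_ge0.
- by apply: mulr_ge0; [apply: mulr_ge0; exact: ltW|exact: grid_ge0].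
- rewrite /A /K -expRM_natl ler_expR mulrCA; apply: ler_wpM2l => //.
  by rewrite -[leRHS](stepE l n) ler_pM2r ?step_gt0// ler_nat.
- apply: ler_wpM2l; first by apply: mulr_ge0; exact: ltW.
  exact: (grid_le_last T_gt0 l_gt0 TlE).
Unshelve. all: by end_near. Qed.

End convergence.

Lemma cvg_riemann_sum_sqr (x : R -> R) (y : nat -> nat -> R) :
  {within `[0, T[, continuous x} ->
  (forall e : R, 0 < e -> \forall n \near \oo, forall k, (k <= n.+1)%N ->
     `|y n k - x (grid n k)| <= e) ->
  \sum_(k < n.+1) mesh n k * (y n k / remaining n k) ^+ 2 @[n --> \oo] -->
  Rintegral lebesgue_measure `[0, t] (fun u => x u ^+ 2 / (T - u) ^+ 2).
Proof.
move=> cx yx.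
have tT := t_lt_T T_gt0 TlE.
have t0 := t_gt0 T_gt0 l_gt0 TlE.
have cg := within_continuous_div_remaining cx.
set g := (fun u => x u / (T - u)) in cg.
have -> : (fun u => x u ^+ 2 / (T - u) ^+ 2) = (fun u => g u ^+ 2).
  by apply/funext => u; rewrite /g expr_div_n.
apply: (cvg_riemann_sum T_gt0 l_gt0 TlE
  (y := fun n k => (y n k / remaining n k) ^+ 2)).
  move/subspace_continuousP : cg => cg; apply/subspace_continuousP => u uT.
  by apply: cvgM; exact: cg.
have cgt : {within `[0, t], continuous g}.
  apply: continuous_subspaceW cg => u /=; rewrite !in_itv/= => /andP[-> ut].
  exact: le_lt_trans ut tT.
have [M M0 gM] := segment_bounded (ltW t0) cgt.
move=> e e0.
(* For [z] within [ep <= 1] of [g], the factor [z + g] in [z^2 - g^2] is at most [2 * M + 1] in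
   absolute value. *)
pose ep := Num.min 1 (e / (2 * M + 1)).
have M1 : 0 < 2 * M + 1 by rewrite ltr_wpDl// mulr_ge0.
have ep0 : 0 < ep by rewrite lt_min ltr01 divr_gt0.
have Tt : 0 < T - t by rewrite subr_gt0.
have := yx (ep * (T - t)) (mulr_gt0 ep0 Tt); apply: filterS => n yn k kn.
have r0 : 0 < remaining n k by exact: remaining_gt0.
have rE : T - grid n k = remaining n k by rewrite /grid opprB addrCA subrr addr0.
have zg : `|y n k / remaining n k - g (grid n k)| <= ep.
  rewrite /g rE -mulrBl normrM (gtr0_norm (_ : 0 < (remaining n k)^-1)) ?invr_gt0//.
  rewrite ler_pdivrMr//; apply: (le_trans (yn k (leqW kn))).
  by apply: ler_wpM2l; [exact: ltW|apply: (remaining_ge T_gt0 l_gt0 TlE); exact: leqW].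
have gk : `|g (grid n k)| <= M.
  by apply: gM; apply: (grid_itv T_gt0 l_gt0 TlE); exact: leqW.
rewrite subr_sqr normrM.
apply: (@le_trans _ _ (ep * (2 * M + 1))); last first.
  rewrite -ler_pdivlMr//; by rewrite ge_min lexx orbT.
apply: ler_pM => //.
rewrite [X in `|X|](_ : _ = (y n k / remaining n k - g (grid n k)) + g (grid n k) *+ 2); last by ring.
apply: (le_trans (ler_normD _ _)); rewrite addrC; apply: lerD.
  by rewrite normrMn -[leLHS]mulr_natl; apply: ler_wpM2l.
by apply: le_trans zg _; by rewrite ge_min lexx.
Qed.

End euler_scheme.

(** * The Riccati recursion *)

Section riccati.
Context {R : realType}.
Variables (lam1 lam2 A B : R).
Hypotheses (lam1_gt0 : 0 < lam1) (lam2_lt0 : lam2 < 0) (A_ge0 : 0 <= A).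
Hypotheses (AB1 : A + B = 1) (slope_ge0 : 0 <= A * lam1 + B * lam2).

(* The Riccati equation is linearised by [phi ~ h'/(2 h)]. *)
Definition riccati_lin (r : R) : R := A * expR (lam1 * r) + B * expR (lam2 * r).
Local Notation h := riccati_lin.

Lemma riccati_lin0 : h 0 = 1.
Proof. by rewrite /h !mulr0 expR0 !mulr1. Qed.

(** The coefficient [B] may be negative, and then both terms of the increment are nonnegative.
    Otherwise [1 + x <= expR x] bounds the increment below by a positive multiple of the initial
    slope [A * lam1 + B * lam2]. *)
Lemma riccati_lin_nondecreasing r s : 0 <= r -> 0 <= s -> h r <= h (r + s).
Proof.
move=> r0 s0; rewrite -subr_ge0.
have -> : h (r + s) - h r = A * (expR (lam1 * r) * (expR (lam1 * s) - 1)) +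
    B * (expR (lam2 * r) * (expR (lam2 * s) - 1)).
  by rewrite /h !mulrDr !expRD; ring.
have e1 : lam1 * s <= expR (lam1 * s) - 1 by rewrite lerBrDl expR_ge1Dx.
have e2 : lam2 * s <= expR (lam2 * s) - 1 by rewrite lerBrDl expR_ge1Dx.
have l1s : 0 <= lam1 * s by rewrite mulr_ge0// ltW.
have e3 : expR (lam2 * s) - 1 <= 0 by rewrite subr_le0 expR_le1 mulr_le0_ge0// ltW.
have e12 : expR (lam2 * r) <= expR (lam1 * r).
  by rewrite ler_expR ler_wpM2r// ltW// (lt_trans lam2_lt0).
have p2 := expR_gt0 (lam2 * r).
have first_ge : A * (expR (lam2 * r) * (lam1 * s)) <=
    A * (expR (lam1 * r) * (expR (lam1 * s) - 1)).
  by apply: ler_wpM2l => //; apply: ler_pM => //; exact: ltW.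
have [B0|B0] := leP 0 B.
  have second_ge : B * (expR (lam2 * r) * (lam2 * s)) <=
      B * (expR (lam2 * r) * (expR (lam2 * s) - 1)).
    by apply: ler_wpM2l => //; apply: ler_wpM2l => //; exact: ltW.
  apply: (le_trans _ (lerD first_ge second_ge)).
  have -> : A * (expR (lam2 * r) * (lam1 * s)) + B * (expR (lam2 * r) * (lam2 * s)) =
      (A * lam1 + B * lam2) * (expR (lam2 * r) * s) by ring.
  by apply: mulr_ge0 => //; apply: mulr_ge0 => //; exact: ltW.
apply: addr_ge0.
  apply: le_trans first_ge; apply: mulr_ge0 => //.
  by apply: mulr_ge0 => //; exact: ltW.
rewrite mulr_le0//; first exact: ltW.
by apply: mulr_ge0_le0 => //; exact: ltW.
Qed.

Lemma riccati_lin_gt0 r : 0 <= r -> 0 < h r.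
Proof.
move=> r0; rewrite (@lt_le_trans _ _ 1)//.
by rewrite -riccati_lin0 -[r]add0r; exact: riccati_lin_nondecreasing.
Qed.

(** * Exact solution of the discrete Riccati recursion *)

Section discrete.
Variables (T t l : R).
Hypotheses (T_gt0 : 0 < T) (l_gt0 : 0 < l) (TlE : T * expR (- l) = T - t).
Local Notation step := (step l).
Local Notation remaining := (remaining T l).
Local Notation grid := (grid T l).
Local Notation mesh := (mesh T l).

Let H n m := h (m%:R * step n).

Let H_gt0 n m : 0 < H n m.
Proof. by apply: riccati_lin_gt0; rewrite mulr_ge0// ltW// step_gt0. Qed.

Let H_le n m : H n m <= H n m.+1.
Proof.
rewrite /H -natr1 mulrDl mul1r; apply: riccati_lin_nondecreasing.
  by rewrite mulr_ge0// ltW// step_gt0.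
by rewrite ltW// step_gt0.
Qed.

(** This is [c_n]: the value for which [riccati_sol] solves the discrete recursion exactly. *)
Definition riccati_weight n : R :=
  expR (- step n) * ((expR (lam1 * step n) - 1) * (1 - expR (lam2 * step n))) /
  (2 * (1 - expR (- step n)) ^+ 2).

(** Discrete counterpart of [h' / (2 h)], evaluated at the logarithmic time left until [t], so the
    argument of [h] decreases in [k]. At [k = n.+1] the ratio is [h (step n) / h 0], which makes
    [riccati_sol n n.+1] the constant [p_n]. *)
Definition riccati_sol n k : R :=
  expR (- step n) * (h ((n.+2 - k)%:R * step n) / h ((n.+1 - k)%:R * step n) - 1) /
  (2 * (1 - expR (- step n)) * remaining n k).

Let q1 n : 0 < 1 - expR (- step n).
Proof. by rewrite subr_gt0 expNstep_lt1. Qed.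

Lemma riccati_weight_ge0 n : 0 <= riccati_weight n.
Proof.
apply: divr_ge0.
  apply: mulr_ge0; first exact: expR_ge0.
  apply: mulr_ge0; rewrite subr_ge0.
    by rewrite -[leLHS]expR0 ler_expR mulr_ge0// ltW// step_gt0.
  by rewrite expR_le1 mulr_le0_ge0// ltW// step_gt0.
by apply: mulr_ge0 => //; exact: sqr_ge0.
Qed.

Lemma riccati_sol_ge0 n k : (k <= n.+1)%N -> 0 <= riccati_sol n k.
Proof.
move=> kn; apply: divr_ge0; last first.
  by rewrite !mulr_ge0// ltW// remaining_gt0.
apply: mulr_ge0; first exact: expR_ge0.
rewrite subr_ge0 ler_pdivlMr; last exact: H_gt0.
by rewrite mul1r (subSn kn); exact: H_le.
Qed.

(** The prefactor of [riccati_sol] cancels against [mesh], leaving a ratio of consecutive values of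
    [h]; this is why the product of the normalising factors telescopes. *)
Lemma riccati_sol_factor n k : (k <= n)%N ->
  1 + 2 * riccati_sol n k.+1 * mesh n k =
  h ((n.+1 - k)%:R * step n) / h ((n.+1 - k.+1)%:R * step n).
Proof.
move=> kn; rewrite /riccati_sol meshE remainingS subSS.
have h0 := H_gt0 n (n.+1 - k.+1); rewrite /H in h0.
have r0 : 0 < remaining n k by exact: remaining_gt0.
have e0 := expR_gt0 (- step n).
have := q1 n; move: (h _) (h _) (remaining n k) (expR _) h0 r0 e0 => h2 h1 r e h0 r0 e0 qq.
by field; rewrite !gt_eqF.
Qed.

(** With [x1], [x2] the growth factors of the two exponentials over one step, [h] satisfies a
    three-term linear recursion with characteristic roots [x1], [x2], and the condition on
    [lam1 + lam2] makes the squared multiplier equal to [expR (- step n) * (x1 * x2)]. After both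
    substitutions the claim is an identity of rational functions. *)
Lemma riccati_solE alpha n k : lam1 + lam2 = 1 - 2 * alpha -> (k <= n)%N ->
  riccati_sol n k = riccati_weight n * mesh n k / remaining n k ^+ 2 +
   riccati_sol n k.+1 * expR (- (alpha * step n)) ^+ 2 /
   (1 + 2 * riccati_sol n k.+1 * mesh n k).
Proof.
move=> lamE kn; rewrite riccati_sol_factor// /riccati_sol subSS.
rewrite meshE remainingS /riccati_weight.
(* Naming the number of steps left removes the truncated subtractions. *)
have [m mE] : exists m, (n.+1 - k.+1)%N = m by eexists.
have m1E : (n.+1 - k)%N = m.+1 by rewrite subSn// -mE subSS.
have m2E : (n.+2 - k)%N = m.+2 by rewrite subSn ?m1E// leqW.
rewrite mE m1E m2E.
have h0 := H_gt0 n m; have h1 := H_gt0 n m.+1; rewrite /H in h0 h1.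
have r0 : 0 < remaining n k by exact: remaining_gt0.
have e0 := expR_gt0 (- step n).
have qq := q1 n.
set x1 := expR (lam1 * step n); set x2 := expR (lam2 * step n).
have aE : expR (- (alpha * step n)) ^+ 2 = expR (- step n) * (x1 * x2).
  rewrite expr2 /x1 /x2 -!expRD; congr expR.
  by rewrite -[in RHS]mulrDl lamE; ring.
have hE : h (m.+2%:R * step n) = (x1 + x2) * h (m.+1%:R * step n) -
    x1 * x2 * h (m%:R * step n).
  have xE lam j : expR (lam * (j.+1%:R * step n)) =
      expR (lam * step n) * expR (lam * (j%:R * step n)).
    by rewrite -expRD -natr1; congr expR; ring.
  by rewrite /h !xE -/x1 -/x2; ring.
rewrite aE hE.
move: (h (m.+1%:R * step n)) (h (m%:R * step n)) (remaining n k) (expR (- step n))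
  h0 h1 r0 e0 qq => H1 H0 r e h0 h1 r0 e0 qq.
by field; rewrite !gt_eqF.
Qed.

Lemma riccati_sol_last n : riccati_sol n n.+1 =
  expR (- step n) * (h (step n) - 1) / (2 * (1 - expR (- step n)) * (T - t)).
Proof.
rewrite /riccati_sol subnn subSnn mul1r mul0r riccati_lin0 divr1.
by rewrite /remaining stepE TlE.
Qed.

Lemma prod_riccati_sol n :
  \prod_(k < n.+1) (Num.sqrt (1 + 2 * riccati_sol n k.+1 * mesh n k))^-1 =
  (Num.sqrt (h l))^-1.
Proof.
have H' k : (k <= n.+1)%N ->
    \prod_(i < k) (Num.sqrt (1 + 2 * riccati_sol n i.+1 * mesh n i))^-1 =
    Num.sqrt (H n (n.+1 - k)) / Num.sqrt (H n n.+1).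
  elim: k => [_|k IH kn].
    by rewrite big_ord0 subn0 divff// gt_eqF// sqrtr_gt0 H_gt0.
  rewrite big_ord_recr/= IH ?(ltnW kn)// riccati_sol_factor//.
  rewrite -/(H n _) -/(H n _) sqrtrM ?(ltW (H_gt0 _ _))// sqrtrV ?(ltW (H_gt0 _ _))//.
  by field; rewrite !gt_eqF ?sqrtr_gt0 ?H_gt0.
rewrite H'// subnn {1}/H mul0r riccati_lin0 sqrtr1 div1r /H stepE.
by [].
Qed.

Lemma cvg_expR_step (c : R) : expR (c * step n) @[n --> \oo] --> (1 : R).
Proof.
rewrite -expR0; apply: continuous_cvg; first exact: continuous_expR.
by rewrite -(mulr0 c); apply: cvgM; [exact: cvg_cst|exact: cvg_step].
Qed.

(** Numerator and denominator are both of order [step n ^+ 2]; dividing each small factor by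
    [step n] turns it into a difference quotient of the exponential at 0. *)
Lemma cvg_riccati_weight :
  riccati_weight n @[n --> \oo] --> - (lam1 * lam2) / 2.
Proof.
have Q := @cvg_expR_step_quot _ l l_gt0.
have -> : riccati_weight = (fun n => expR (-1 * step n) *
    (((expR (lam1 * step n) - 1) / step n) * - ((expR (lam2 * step n) - 1) / step n)) *
    (2^-1 * ((expR (-1 * step n) - 1) / step n)^-1 * ((expR (-1 * step n) - 1) / step n)^-1)).
  apply/funext => n; rewrite /riccati_weight mulN1r.
  have s0 := step_gt0 l_gt0 n; have qq := q1 n.
  have qq' : expR (- step n) - 1 != 0 by rewrite -opprB oppr_eq0 gt_eqF.
  by field; rewrite qq' !gt_eqF.
have -> : - (lam1 * lam2) / 2 = 1 * (lam1 * - lam2) * (2^-1 * (-1)^-1 * (-1)^-1).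
  by rewrite invrN1; ring.
have N10 : (-1 : R) != 0 by rewrite oppr_eq0 oner_eq0.
apply: cvgM.
  by apply: cvgM; [exact: cvg_expR_step|apply: cvgM; [exact: Q|apply: cvgN; exact: Q]].
apply: cvgM; last by apply: cvgV => //; exact: Q.
by apply: cvgM; [exact: cvg_cst|apply: cvgV => //; exact: Q].
Qed.

Lemma cvg_riccati_sol_last :
  riccati_sol n n.+1 @[n --> \oo] --> (A * lam1 + B * lam2) / (2 * (T - t)).
Proof.
have Q := @cvg_expR_step_quot _ l l_gt0.
have Tt : 0 < T - t by rewrite -TlE mulr_gt0// expR_gt0.
have -> : (fun n => riccati_sol n n.+1) = (fun n => expR (-1 * step n) *
    (A * ((expR (lam1 * step n) - 1) / step n) + B * ((expR (lam2 * step n) - 1) / step n)) *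
    ((- (2 * (T - t))^-1) * ((expR (-1 * step n) - 1) / step n)^-1)).
  apply/funext => n; rewrite riccati_sol_last mulN1r.
  have s0 := step_gt0 l_gt0 n; have qq := q1 n.
  have qq' : expR (- step n) - 1 != 0 by rewrite -opprB oppr_eq0 gt_eqF.
  have -> : h (step n) - 1 =
      A * (expR (lam1 * step n) - 1) + B * (expR (lam2 * step n) - 1).
    rewrite /riccati_lin; have -> : B = 1 - A by rewrite -AB1 addrC addKr.
    by ring.
  by field; rewrite qq' !gt_eqF.
have -> : (A * lam1 + B * lam2) / (2 * (T - t)) =
    1 * (A * lam1 + B * lam2) * ((- (2 * (T - t))^-1) * (-1)^-1).
  by rewrite invrN1; ring.
have N10 : (-1 : R) != 0 by rewrite oppr_eq0 oner_eq0.
apply: cvgM; last by apply: cvgM; [exact: cvg_cst|apply: cvgV => //; exact: Q].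
apply: cvgM; first exact: cvg_expR_step.
by apply: cvgD; apply: cvgM; [exact: cvg_cst|exact: Q|exact: cvg_cst|exact: Q].
Qed.

End discrete.
End riccati.

(** * The functional of the bridge *)

Section bridge_functional.
Context d (Omega : measurableType d) (R : realType) (P : probability Omega R).
Variables (T t l alpha : R) (B X : R -> Omega -> R).
Hypotheses (T_gt0 : 0 < T) (l_gt0 : 0 < l) (TlE : T * expR (- l) = T - t).
Hypothesis WB : standard_Wiener_process P T B.
Hypothesis bridgeX : alpha_Wiener_bridge P T alpha B X.
Variables (mu nu lam1 lam2 A1 A2 : R).
Hypotheses (lam1_gt0 : 0 < lam1) (lam2_lt0 : lam2 < 0).
Hypotheses (lamD : lam1 + lam2 = 1 - 2 * alpha) (lamM : lam1 * lam2 = - (2 * mu)).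
Hypotheses (A1_ge0 : 0 <= A1) (A1A2 : A1 + A2 = 1) (nu_ge0 : 0 <= nu).
(** Terminal condition of the Riccati equation: the initial slope of [h] over [2 * (T - t)] is [nu],
    the limit of [p_n]. *)
Hypothesis slopeE : A1 * lam1 + A2 * lam2 = 2 * nu * (T - t).

Local Notation step := (step l).
Local Notation remaining := (remaining T l).
Local Notation grid := (grid T l).
Local Notation mesh := (mesh T l).
Local Notation weight := (riccati_weight lam1 lam2 l).
Local Notation phi := (riccati_sol lam1 lam2 A1 A2 T l).

Let Tt_gt0 : 0 < T - t.
Proof. by rewrite -TlE mulr_gt0// expR_gt0. Qed.

Let slope_ge0 : 0 <= A1 * lam1 + A2 * lam2.
Proof. by rewrite slopeE !mulr_ge0// ltW. Qed.

Let grid_ltT n k : 0 <= grid n k < T.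
Proof. by rewrite grid_ge0//= /grid gtrBl remaining_gt0. Qed.

Let Z n k w := B (grid n k.+1) w - B (grid n k) w.
Let Y n k := chain (Z n) (expR (- (alpha * step n))) k.
Let cost n k := weight n * mesh n k / remaining n k ^+ 2.

(** Kept for an arbitrary array [y], since it is used both on the scheme [Y] and on the exact
    samples of [X]. *)
Let discrete_functional (y : nat -> nat -> R) n :=
  expR (- (\sum_(k < n.+1) cost n k * y n k ^+ 2) - phi n n.+1 * y n n.+1 ^+ 2).

Let F w := expR (- mu * Rintegral lebesgue_measure `[0, t]
                          (fun u => X u w ^+ 2 / (T - u) ^+ 2) - nu * X t w ^+ 2).

Let cvg_discrete_functional w (y : nat -> nat -> R) :
  (forall e : R, 0 < e -> \forall n \near \oo, forall k, (k <= n.+1)%N ->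
     `|y n k - X (grid n k) w| <= e) ->
  discrete_functional y n @[n --> \oo] --> F w.
Proof.
move=> yX; have [_ cX _ _] := bridgeX.
suff H : - (\sum_(k < n.+1) cost n k * y n k ^+ 2) - phi n n.+1 * y n n.+1 ^+ 2
    @[n --> \oo] --> - mu * Rintegral lebesgue_measure `[0, t]
      (fun u => X u w ^+ 2 / (T - u) ^+ 2) - nu * X t w ^+ 2.
  by apply: (cvg_comp _ expR H); exact: continuous_expR.
apply: cvgB.
  have -> : (fun n => - (\sum_(k < n.+1) cost n k * y n k ^+ 2)) =
      (fun n => - weight n * \sum_(k < n.+1) mesh n k * (y n k / remaining n k) ^+ 2).
    apply/funext => n; rewrite mulNr mulr_sumr; congr (- _).
    apply: eq_bigr => k _; rewrite /cost expr_div_n.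
    have : remaining n k != 0 by rewrite gt_eqF// remaining_gt0.
    move: (remaining n k) (mesh n k) => r m r0; field.
    exact: r0.
  apply: cvgM; last exact: (cvg_riemann_sum_sqr T_gt0 l_gt0 TlE (cX w) yX).
  apply: cvgN; have -> : mu = - (lam1 * lam2) / 2 by rewrite lamM opprK mulrC mulKf.
  exact: cvg_riccati_weight.
have cphi : phi n n.+1 @[n --> \oo] --> nu.
  have -> : nu = (A1 * lam1 + A2 * lam2) / (2 * (T - t)).
    by rewrite slopeE; field; rewrite gt_eqF.
  exact: cvg_riccati_sol_last.
have cy : y n n.+1 @[n --> \oo] --> X t w.
  apply/cvgrPdist_le => e e0; have := yX e e0; apply: filterS => n /(_ n.+1 (leqnn _)).
  by rewrite (grid_last TlE) distrC.
by apply: cvgM => //; apply: cvgM.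
Qed.

Let measurable_B n k : measurable_fun setT (B (grid n k)).
Proof. by have [mB _ _ _ _] := WB; apply: mB. Qed.

Let measurable_Z n k : measurable_fun setT (Z n k).
Proof. by apply: measurable_funB; exact: measurable_B. Qed.

Let measurable_discrete_functional (y : nat -> nat -> Omega -> R) n :
  (forall k, (k <= n.+1)%N -> measurable_fun setT (y n k)) ->
  measurable_fun setT (fun w => discrete_functional (fun n k => y n k w) n).
Proof.
move=> my; apply: measurableT_comp => //; apply: measurable_funB.
  apply: measurableT_comp => //; apply: measurable_sum => k.
  by apply: measurable_funM => //; apply: measurable_funX; apply: my; exact: ltnW.
by apply: measurable_funM => //; apply: measurable_funX; exact: my.
Qed.

(** [F] is the limit of the discrete functionals of the samples of [X], which depend on finitely
    many random variables; the limit holds at every [w], as every path is continuous. *)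
Let measurable_F : measurable_fun setT F.
Proof.
have [mX _ _ _] := bridgeX.
apply: (@measurable_fun_cvg _ _ _ _
  (fun n w => discrete_functional (fun n k => X (grid n k) w) n)).
  move=> n; apply: (@measurable_discrete_functional (fun n k => X (grid n k))).
  by move=> k _; exact: mX.
move=> w _; apply: cvg_discrete_functional => e e0; apply: nearW => n k _.
by rewrite subrr normr0 ltW.
Qed.

Let expectation_discrete n :
  (\int[P]_w (discrete_functional (fun n k => Y n k w) n)%:E =
   ((Num.sqrt (riccati_lin lam1 lam2 A1 A2 l))^-1)%:E)%E.
Proof.
have [_ _ _ lawB indepB] := WB.
have m0 k : 0 < mesh n k by exact: mesh_gt0.
pose s k := Num.sqrt (mesh n k).
have sE k : s k ^+ 2 = mesh n k by rewrite sqr_sqrtr// ltW.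
transitivity (\int[P]_w (expR (- chain_cost (Z n) (expR (- (alpha * step n))) (cost n) n.+1 w
   - phi n n.+1 * chain (Z n) (expR (- (alpha * step n))) n.+1 w ^+ 2))%:E)%E.
  by [].
rewrite (@gaussian_chain_expectation _ _ _ _ _ _ _ _ _ _ s (phi n)).
- under eq_bigr do rewrite sE.
  by rewrite prod_riccati_sol.
- by [].
- have := indepB n.+1 (fun i => grid n i); apply => //.
  + exact: grid_ge0.
  + by case/andP : (grid_ltT n n.+1).
  + by move=> i; exact: grid_lt.
- by move=> i _; rewrite sqrtr_gt0.
- move=> i _ C mC; apply: lawB => //.
  + exact: grid_ge0.
  + exact: grid_lt.
  + by case/andP : (grid_ltT n i.+1).
- by move=> i ilt; exact: riccati_sol_ge0.
- by move=> i ilt; rewrite sE; exact: riccati_solE.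
Qed.

Let discrete_functional_le1 y n : discrete_functional y n <= 1.
Proof.
rewrite -[leRHS]expR0 ler_expR -opprD oppr_le0; apply: addr_ge0.
  apply: sumr_ge0 => k _; apply: mulr_ge0; last exact: sqr_ge0.
  apply: divr_ge0; last exact: sqr_ge0.
  by apply: mulr_ge0; [exact: riccati_weight_ge0|exact/ltW/mesh_gt0].
by apply: mulr_ge0; [exact: riccati_sol_ge0|exact: sqr_ge0].
Qed.

Lemma bridge_functional_expectation :
  (\int[P]_w (F w)%:E = ((Num.sqrt (riccati_lin lam1 lam2 A1 A2 l))^-1)%:E)%E.
Proof.
have [_ cX X0 XE] := bridgeX.
pose f_ n w := (discrete_functional (fun n k => Y n k w) n)%:E.
have mf_ n : measurable_fun setT (f_ n).
  apply/measurable_EFinP/measurable_discrete_functional => k kn.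
  by apply: (@measurable_chain _ _ _ n.+1) => // i _; exact: measurable_Z.
have mF : measurable_fun setT (EFin \o F) by exact/measurable_EFinP.
(* Convergence is only almost sure here, because the scheme is compared with [X] through the
   integral equation and the initial value. *)
have f_F : {ae P, forall w, setT w -> f_ ^~ w @ \oo --> (EFin \o F) w}.
  apply: filterS2 X0 XE => w X0w XEw _; apply: cvg_EFin; first exact: nearW.
  apply: cvg_discrete_functional => e e0.
  exact: (@euler_scheme_cvg _ T t l T_gt0 l_gt0 TlE alpha (X ^~ w) (B ^~ w)).
have i1 : P.-integrable setT (cst 1%E : Omega -> \bar R).
  by apply: finite_measure_integrable_cst.
have f_1 : {ae P, forall w n, setT w -> (`|f_ n w| <= (cst 1%E : Omega -> \bar R) w)%E}.
  apply: aeW => w n _; rewrite /f_ /= lee_fin ger0_norm ?expR_ge0//.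
have [_ _] := dominated_convergence measurableT mf_ mF f_F i1 f_1.
(* The expectations do not depend on [n], so their limit is this common value. *)
rewrite (_ : (fun n => _) = (fun=> ((Num.sqrt (riccati_lin lam1 lam2 A1 A2 l))^-1)%:E)); last first.
  by apply/funext => n; exact: expectation_discrete.
by move=> /cvg_lim <-//; rewrite lim_cst.
Qed.

End bridge_functional.

(** * Roots, coefficients and the hyperbolic form *)

Section closed_form.
Context {R : realType}.
Variables (mu alpha p D : R).
Hypotheses (mu_gt0 : 0 < mu) (p_ge0 : 0 <= p).
Hypothesis DE : D = Num.sqrt (8 * mu + (2 * alpha - 1) ^+ 2).

Lemma discriminantE : D ^+ 2 = 8 * mu + (2 * alpha - 1) ^+ 2.
Proof. by rewrite DE sqr_sqrtr// addr_ge0 ?sqr_ge0// mulr_ge0// ltW. Qed.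

Lemma discriminant_gt : `|2 * alpha - 1| < D.
Proof. by rewrite DE -sqrtr_sqr ltr_sqrt; rewrite ?ltrDr ?ltr_wpDr ?sqr_ge0 ?mulr_gt0. Qed.

Let D_gt0 : 0 < D := le_lt_trans (normr_ge0 _) discriminant_gt.
(** Coefficients [(1 + c) / 2] and [(1 - c) / 2] have sum 1, and this [c] gives them the slope
    [2 * p]; [p] stands for [nu * (T - t)]. *)
Let c := (4 * p + 2 * alpha - 1) / D.
Let lam1 := (D - (2 * alpha - 1)) / 2.
Let lam2 := - (D + (2 * alpha - 1)) / 2.

(** Factoring out the exponential of the mean of the two roots leaves [cosh - c sinh]. The argument
    is written with [- l], which becomes [L] in the theorem. *)
Lemma riccati_lin_cosh (l : R) :
  riccati_lin lam1 lam2 ((1 + c) / 2) ((1 - c) / 2) l =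
  expR ((2 * alpha - 1) / 2 * - l) *
  (coshR (D / 2 * - l) + (1 - 2 * alpha - 4 * p) / D * sinhR (D / 2 * - l)).
Proof.
rewrite /riccati_lin /coshR /sinhR.
have -> : lam1 * l = (2 * alpha - 1) / 2 * - l + - (D / 2 * - l) by rewrite /lam1; field.
have -> : lam2 * l = (2 * alpha - 1) / 2 * - l + D / 2 * - l by rewrite /lam2; field.
rewrite !expRD /c.
move: (expR _) (expR _) (expR _) => x y z.
by field; rewrite gt_eqF.
Qed.

Lemma riccati_parameters :
  [/\ 0 < lam1, lam2 < 0, lam1 + lam2 = 1 - 2 * alpha, lam1 * lam2 = - (2 * mu) &
   [/\ 0 <= (1 + c) / 2, (1 + c) / 2 + (1 - c) / 2 = 1 &
    (1 + c) / 2 * lam1 + (1 - c) / 2 * lam2 = 2 * p]].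
Proof.
have := discriminant_gt; rewrite ltr_norml => /andP[Dl Dr].
split.
- by rewrite /lam1; lra.
- by rewrite /lam2; lra.
- by rewrite /lam1 /lam2; field.
- rewrite /lam1 /lam2; have -> : (D - (2 * alpha - 1)) / 2 * (- (D + (2 * alpha - 1)) / 2) =
    - ((D ^+ 2 - (2 * alpha - 1) ^+ 2) / 4) by field.
  by rewrite discriminantE; field.
- split.
  + have : -1 <= c.
      rewrite /c ler_pdivlMr// mulN1r; apply: (le_trans (ltW Dl)).
      by rewrite -addrA lerDr mulr_ge0.
    by move: (c) => c'; lra.
  + by move: (c) => c'; field.
  + by rewrite /lam1 /lam2 /c; field; rewrite gt_eqF.
Qed.

End closed_form.

Theorem mainTheorem11 (d : measure_display) (Omega : measurableType d)
  (R : realType) (P : probability Omega R) (T alpha : R)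
  (B X : R -> Omega -> R) :
  0 < T ->
  standard_Wiener_process P T B ->
  alpha_Wiener_bridge P T alpha B X ->
  forall (mu nu t : R), 0 < mu -> 0 <= nu -> 0 <= t -> t < T ->
  let D := Num.sqrt (8 * mu + (2 * alpha - 1) ^+ 2) in
  let L := ln (1 - t / T) in
  let F := fun w => expR (- mu * Rintegral lebesgue_measure `[0, t]
                                   (fun u => X u w ^+ 2 / (T - u) ^+ 2)
                         - nu * X t w ^+ 2) in
  ('E_P[F])%E =
  ((1 - t / T) `^ ((1 - 2 * alpha) / 4) /
     Num.sqrt (coshR (D / 2 * L)
               + (1 - 2 * alpha - 4 * nu * (T - t)) / D * sinhR (D / 2 * L)))%:E.
Proof.
move=> T_gt0 WB bridgeX mu nu t mu_gt0 nu_ge0 t_ge0 tT D L F.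
rewrite unlock.
(* At [t = 0] the logarithmic length [- L] vanishes and there is no grid; both sides are 1 because
   [X 0 = 0] almost surely. *)
have [t0|t_neq0] := eqVneq t 0.
  have [mX _ X0 _] := bridgeX.
  have LE : L = 0 by rewrite /L t0 mul0r subr0 ln1.
  rewrite {1}t0 mul0r subr0 powR1 LE !mulr0 /coshR /sinhR oppr0 expR0 subrr mul0r mulr0.
  rewrite addr0 -(natrD R 1 1) divff// sqrtr1 divr1.
  have FE w : F w = expR (- nu * X 0 w ^+ 2).
    by rewrite /F t0 set_itv1 Rintegral_set1 mulr0 sub0r mulNr.
  rewrite -[RHS](_ : (\int[P]_w (1%:E) = 1)%E); last first.
    by rewrite integral_cst// mul1e; exact: probability_setT.
  apply: ae_eq_integral => //.
    rewrite (_ : (fun w => _) = EFin \o (fun w => expR (- nu * X 0 w ^+ 2))).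
      apply/measurable_EFinP/measurableT_comp => //; apply: measurable_funM => //.
      by apply: measurable_funX; apply: mX; rewrite lexx.
    by apply/funext => w /=; rewrite FE.
  apply: filterS X0 => w X0w _.
  by rewrite FE X0w expr0n/= mulr0 expR0.
have t_gt0 : 0 < t by rewrite lt_neqAle eq_sym t_neq0.
have y_gt0 : 0 < 1 - t / T by rewrite subr_gt0 ltr_pdivrMr// mul1r.
have y_lt1 : 1 - t / T < 1 by rewrite ltrBlDr ltrDl divr_gt0.
have l_gt0 : 0 < - L by rewrite oppr_gt0 ln_lt0// y_gt0.
have TlE : T * expR (- - L) = T - t.
  by rewrite opprK /L lnK ?posrE//; field; rewrite gt_eqF.
have p_ge0 : 0 <= nu * (T - t) by rewrite mulr_ge0// subr_ge0 ltW.
have [l1 l2 lD lM [A0 A1 Asl]] := riccati_parameters mu_gt0 p_ge0 (erefl D).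
rewrite (bridge_functional_expectation T_gt0 l_gt0 TlE WB bridgeX l1 l2 lD lM A0 A1 nu_ge0);
  last by rewrite Asl mulrA.
congr (_%:E).
rewrite (riccati_lin_cosh _ mu_gt0 (erefl D)) opprK.
have -> : 1 - 2 * alpha - 4 * (nu * (T - t)) = 1 - 2 * alpha - 4 * nu * (T - t).
  by rewrite mulrA.
rewrite sqrtrM ?expR_ge0// invfM; congr (_ * _).
rewrite /powR gt_eqF// -/L.
(* Written as a square, the prefactor leaves the square root, and its inverse is the required power
   of [1 - t / T]. *)
have -> : expR ((2 * alpha - 1) / 2 * L) = expR ((2 * alpha - 1) / 4 * L) ^+ 2.
  by rewrite expr2 -expRD; congr expR; field.
rewrite sqrtr_sqr ger0_norm ?expR_ge0// -expRN; congr expR.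
by field.
Qed.
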